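(* Let $K$ be a field of characteristic zero and let $G=\bigoplus_{i=0}^{D}G_i\cong K[x_1,\ldots,x_n]/I$ be a standard graded Gorenstein Artinian $K$-algebra of socle degree $D$ and codimension $n=\dim_K G_1\geq 1$ that has the Weak Lefschetz property (WLP), and let $f\in G_1$ be a nonzero linear element. Put $k:=\lfloor D/2\rfloor$ and assume that either $D$ is odd, or $D$ is even and $\dim_K(G_{k-1})=\dim_K(G_k)$. Then the quotient ring $$A=\frac{G}{(0:_G f)}$$ is also a standard graded Gorenstein Artinian $K$-algebra. If $A$ and $G$ have the same codimension, then $A$ also has the WLP.
   Context: A standard graded Artinian $K$-algebra $A=\bigoplus_{i=0}^{D}A_i$ (with $A_0=K$, generated by $A_1$, finite-dimensional over $K$, $A_D\neq 0$) has codimension $\dim_K A_1$; when a presentation $A\cong K[x_1,\ldots,x_n]/I$ ($I$ homogeneous) is written, $n$ is the codimension. $A$ has the Weak Lefschetz property (WLP) if there is $L\in A_1$ such that the multiplication map $\times L:A_i\to A_{i+1}$ has maximal rank (is injective or surjective) for every $i=0,\ldots,D-1$. For Gorenstein $A=\bigoplus_{i=0}^D A_i$ with $A_D\ne0$, $D$ is the socle degree of $A$. $(0:_G f)=\{g\in G: gf=0\}$. *)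

(* Defs.v *)
From HB Require Import structures.
From mathcomp Require Import all_boot all_algebra falgebra.

Set Implicit Arguments.
Unset Strict Implicit.
Unset Printing Implicit Defensive.

Import GRing.Theory.
Local Open Scope ring_scope.
Local Open Scope quotient_scope.

(* In an Artinian K-algebra every element is a unit or a zero divisor, so the
   UnitRing part of an falgType carries no extra information: it is supplied
   for any finite-dimensional algebra by Algebra_isFalgebra. *)
#[short(type="comFalgType")]
HB.structure Definition ComFalgebra (K : fieldType) :=
  {A of Falgebra K A & GRing.ComUnitAlgebra K A}.

Section Graded.
Variables (K : fieldType) (A : comFalgType K).
Implicit Types (J : {vspace A}) (Gr : nat -> {vspace A}) (f g : A) (D : nat).

Definition colon0 f : {vspace A} := lker (amulr f).

Lemma mem_colon0 f g : (g \in colon0 f) = (g * f == 0).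
Proof. by rewrite memv_ker lfunE. Qed.

Definition colon0v J : {vspace A} :=
  (\bigcap_(i < \dim J) colon0 (vbasis J)`_i)%VS.

Lemma mem_colon0v J g :
  reflect (forall b, b \in J -> g * b = 0) (g \in colon0v J).
Proof.
apply: (iffP idP) => [gJ b bJ | gJ].
  rewrite (coord_vbasis bJ) mulr_sumr big1 // => i _; rewrite -scalerAr.
  suff /eqP-> : g * (vbasis J)`_i == 0 by rewrite scaler0.
  by rewrite -mem_colon0; apply: subvP gJ; apply: bigcapv_inf.
rewrite memvE; apply/subv_bigcapP => i _; rewrite -memvE mem_colon0.
by rewrite gJ // vbasis_mem // mem_nth // size_tuple.
Qed.

(* The components Gr i with i > D are zero, so A = Gr 0 (+) ... (+) Gr D, with
   finite dimension coming from the type of A. *)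
Record standard_graded_artinian Gr D : Prop := StandardGradedArtinian {
  graded_direct : directv (\sum_(i < D.+1) Gr i);
  graded_sum : (\sum_(i < D.+1) Gr i = fullv)%VS;
  graded_high : forall i, (D < i)%N -> Gr i = 0%VS;
  graded_top : Gr D != 0%VS;
  graded_mul : forall i j, (Gr i * Gr j <= Gr (i + j)%N)%VS;
  graded_0 : Gr 0%N = 1%VS;
  graded_gen : agenv (Gr 1%N) = fullv
}.

Definition irrelevant Gr D : {vspace A} := (\sum_(1 <= i < D.+1) Gr i)%VS.

Definition socle Gr D : {vspace A} := colon0v (irrelevant Gr D).

(* A graded Artinian algebra is local with maximal ideal m := irrelevant Gr D;
   it is Gorenstein when its socle (0 : m) is one-dimensional over K. *)
Definition gorenstein Gr D : Prop := \dim (socle Gr D) = 1%N.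

Definition codimension Gr : nat := \dim (Gr 1%N).

Definition max_rank_mul Gr (L : A) (i : nat) : Prop :=
  {in Gr i &, injective ( *%R L)} \/
  (forall b, b \in Gr i.+1 -> exists2 a, a \in Gr i & L * a = b).

Definition WLP Gr D : Prop :=
  exists2 L, L \in Gr 1%N & forall i, (i < D)%N -> max_rank_mul Gr L i.

Record proper_ideal_space := ProperIdealSpace {
  ideal_space :> {vspace A};
  ideal_spaceP : idealr_closed (pred_of_vspace ideal_space)
}.

Lemma colon0_proper f : f != 0 -> idealr_closed (pred_of_vspace (colon0 f)).
Proof.
move=> f0; split; rewrite ?mem0v ?mem_colon0 ?mul1r //.
by move=> a g h gf hf; rewrite memvD // mem_colon0 -mulrA; move: gf;
  rewrite mem_colon0 => /eqP->; rewrite mulr0.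
Qed.

(* The ideal (0 : f) of a nonzero f; for f = 0 it is the unit ideal, and the
   quotient is not an algebra with 1 != 0. *)
Definition colon0_ideal f (f0 : f != 0) : proper_ideal_space :=
  ProperIdealSpace (colon0_proper f0).

End Graded.

Section Quotient.
Variables (K : fieldType) (A : comFalgType K) (I : proper_ideal_space A).

HB.instance Definition _ :=
  isProperIdeal.Build A (pred_of_vspace (ideal_space I))
    (idealr_closed_nontrivial (ideal_spaceP I)).

Definition quot_alg := {ideal_quot (pred_of_vspace (ideal_space I))}.

HB.instance Definition _ := GRing.ComNzRing.on quot_alg.
HB.instance Definition _ := NzRingQuotient.on quot_alg.

Definition quot_proj (x : A) : quot_alg := \pi_quot_alg x.

Fact quot_projD x y : quot_proj (x + y) = quot_proj x + quot_proj y.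
Proof. exact: (rmorphD (\pi_quot_alg : {rmorphism A -> quot_alg})). Qed.

Fact quot_projM x y : quot_proj (x * y) = quot_proj x * quot_proj y.
Proof. exact: (rmorphM (\pi_quot_alg : {rmorphism A -> quot_alg})). Qed.

Fact quot_proj_eq x y :
  (quot_proj x == quot_proj y) = (x - y \in ideal_space I).
Proof. by rewrite -Quotient.idealrBE. Qed.

Definition quot_scale (a : K) (x : quot_alg) : quot_alg :=
  quot_proj (a *: repr x).

Fact quot_proj_repr x : quot_proj (repr x) = x. Proof. exact: reprK. Qed.

Fact quot_scale_proj a x : quot_scale a (quot_proj x) = quot_proj (a *: x).
Proof.
apply/eqP; rewrite quot_proj_eq -scalerBr memvZ //.
by rewrite -quot_proj_eq quot_proj_repr.
Qed.

Fact quot_scaleA a b v : quot_scale a (quot_scale b v) = quot_scale (a * b) v.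
Proof. by rewrite -[v]quot_proj_repr !quot_scale_proj scalerA. Qed.
Fact quot_scale1 : left_id 1 quot_scale.
Proof. by move=> v; rewrite -[v]quot_proj_repr !quot_scale_proj scale1r. Qed.
Fact quot_scaleDr : right_distributive quot_scale +%R.
Proof.
move=> a u v; rewrite -[u]quot_proj_repr -[v]quot_proj_repr -quot_projD.
by rewrite !quot_scale_proj scalerDr quot_projD.
Qed.
Fact quot_scaleDl v : {morph quot_scale^~ v : a b / a + b}.
Proof.
by move=> a b; rewrite -[v]quot_proj_repr !quot_scale_proj scalerDl quot_projD.
Qed.

HB.instance Definition _ :=
  GRing.Zmodule_isLmodule.Build K quot_alg
    quot_scaleA quot_scale1 quot_scaleDr quot_scaleDl.

Fact quot_scaleAl (a : K) (u v : quot_alg) : a *: (u * v) = (a *: u) * v.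
Proof.
rewrite -[u]quot_proj_repr -[v]quot_proj_repr -quot_projM.
by rewrite /GRing.scale /= !quot_scale_proj -quot_projM scalerAl.
Qed.

HB.instance Definition _ :=
  GRing.Lmodule_isLalgebra.Build K quot_alg quot_scaleAl.
HB.instance Definition _ := GRing.Lalgebra_isComAlgebra.Build K quot_alg.

Lemma quot_proj_linear : linear quot_proj.
Proof. by move=> a x y; rewrite quot_projD -quot_scale_proj. Qed.
HB.instance Definition _ :=
  GRing.isLinear.Build K A quot_alg _ quot_proj quot_proj_linear.

Lemma quot_proj_monoid_morphism : monoid_morphism quot_proj.
Proof.
split; last exact: quot_projM.
exact: (rmorph1 (\pi_quot_alg : {rmorphism A -> quot_alg})).
Qed.
HB.instance Definition _ :=
  GRing.isMonoidMorphism.Build A quot_alg quot_proj quot_proj_monoid_morphism.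

Lemma quot_proj_surj (x : quot_alg) : exists a, quot_proj a = x.
Proof. by exists (repr x); apply: reprK. Qed.

Lemma quot_proj_eq0 (a : A) : (quot_proj a == 0) = (a \in ideal_space I).
Proof. by rewrite -(raddf0 quot_proj) quot_proj_eq subr0. Qed.

Import VectorInternalTheory.

(* The vector space structure of A / I is transported from a complement of I. *)
Local Notation C := (complv (ideal_space I)).
Definition quot_lift (x : quot_alg) : subvs_of C :=
  vsproj C (daddv_pi C (ideal_space I) (repr x)).

Fact quot_cap_compl : (C :&: ideal_space I = 0)%VS.
Proof. by rewrite capvC capv_compl. Qed.

Fact quot_projK x : quot_proj (vsval (quot_lift x)) = x.
Proof.
rewrite /quot_lift vsprojK ?memv_pi //; apply/eqP.
rewrite -[eqbRHS]quot_proj_repr quot_proj_eq.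
have xCI : repr x \in (C + ideal_space I)%VS by rewrite addvC addv_complf memvf.
have := daddv_pi_add quot_cap_compl xCI.
have := memv_pi (ideal_space I) C (repr x).
move: (daddv_pi C _ _) (daddv_pi _ C _) => p q qI <-.
by rewrite opprD addrA subrr sub0r memvN.
Qed.

Fact quot_liftK (u : subvs_of C) : quot_lift (quot_proj (vsval u)) = u.
Proof.
apply/val_inj/eqP; rewrite -subr_eq0 -memv0 -quot_cap_compl memv_cap.
by rewrite memvB ?subvsP //= -quot_proj_eq; apply/eqP; apply: quot_projK.
Qed.

Fact quot_lift_linear : linear quot_lift.
Proof.
move=> a x y; rewrite -[in LHS](quot_projK x) -[in LHS](quot_projK y).
by rewrite -!linearP quot_liftK.
Qed.

Fact quot_vect_iso : Vector.axiom (dim (subvs_of C)) quot_alg.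
Proof.
exists (v2r \o quot_lift) => [a x y | ].
  by rewrite /= quot_lift_linear linearP.
exists (quot_proj \o vsval \o r2v) => [x | u] /=.
  by rewrite v2rK quot_projK.
by rewrite quot_liftK r2vK.
Qed.

HB.instance Definition _ := Lmodule_hasFinDim.Build K quot_alg quot_vect_iso.
HB.instance Definition _ := Algebra_isFalgebra.Build K quot_alg.

Definition quot_grading (Gr : nat -> {vspace A}) (i : nat) :
    {vspace quot_alg} :=
  (linfun quot_proj @: Gr i)%VS.

End Quotient.

(* Main.v *)
Require Import Defs.
From HB Require Import structures.
From mathcomp Require Import all_boot all_algebra falgebra zify.

Import GRing.Theory.
Local Open Scope ring_scope.

(* As graded modules, G / (0 : f) is the principal ideal f G shifted by one
   degree, so it has socle degree D - 1 and its socle embeds into that of G.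
   The hypothesis on D, with the symmetry of the Hilbert function when D is
   odd, yields some m with dim G_m = dim G_(m+1), hence a Lefschetz element L
   that is bijective there. As the socle sits in degree D, L is then injective
   on G_i for i <= m, and as G is generated in degree 1, L maps G_i onto
   G_(i+1) for i >= m. Injectivity on G_(i+1) restricts to f G_i, and
   surjectivity passes to the quotient, which covers every degree. *)

(** * Graded algebras generated in degree one, and their socle *)

Section GradedTheory.
Set Implicit Arguments.
Unset Strict Implicit.
Variables (K : fieldType) (A : comFalgType K).
Variables (Gr : nat -> {vspace A}) (D : nat).
Hypothesis A_graded : standard_graded_artinian Gr D.

Lemma mul_graded {i j x y} :
  x \in Gr i -> y \in Gr j -> x * y \in Gr (i + j)%N.
Proof.
move=> xi yj; apply: (subvP (graded_mul A_graded i j)).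
exact: memv_mul.
Qed.

(** Indexing by [nat] instead of ['I_D.+1] costs nothing, since the components above [D] are
    zero. *)
Lemma graded_unique {us : nat -> A} : (forall i, us i \in Gr i) ->
  \sum_(i < D.+1) us i = 0 -> forall i, us i = 0.
Proof.
move=> usP us0 i; have [iD | Di] := ltnP i D.+1; last first.
  by apply/eqP; rewrite -memv0 -(graded_high A_graded Di).
have /directv_sum_independent dx := graded_direct A_graded.
exact: (dx (fun j : 'I_D.+1 => us j) (fun j _ => usP j) us0 (Ordinal iD)).
Qed.

Lemma graded_disjoint {i j x} :
  x \in Gr i -> x \in Gr j -> i != j -> x = 0.
Proof.
move=> xi xj ij; have [iD | Di] := ltnP D i.
  by apply/eqP; rewrite -memv0 -(graded_high A_graded iD).
have [jD | Dj] := ltnP D j.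
  by apply/eqP; rewrite -memv0 -(graded_high A_graded jD).
(* Placing [x] in degree [i] and [- x] in degree [j] gives a decomposition of zero. *)
pose us k := if k == i then x else if k == j then - x else 0.
have usP k : us k \in Gr k.
  rewrite /us; case: eqP => [->//|_]; case: eqP => [->|_]; last exact: mem0v.
  by rewrite memvN.
suff /(graded_unique usP)/(_ i) : \sum_(k < D.+1) us k = 0 by rewrite /us eqxx.
have iD : (i < D.+1)%N by []; have jD : (j < D.+1)%N by [].
rewrite (bigD1 (Ordinal iD)) //= (bigD1 (Ordinal jD)) /=; last first.
  by rewrite -val_eqE /= eq_sym.
rewrite big1 => [|k /andP[]]; last first.
  by rewrite /us -!val_eqE /= => /negPf-> /negPf->.
by rewrite /us eqxx eq_sym (negPf ij) eqxx addr0 subrr.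
Qed.

Lemma expv_sub_graded i : (Gr 1%N ^+ i <= Gr i)%VS.
Proof.
elim: i => [|i IHi]; first by rewrite expv0 (graded_0 A_graded).
rewrite expvSl (subv_trans (prodvSr _ IHi)) //.
exact: (graded_mul A_graded 1 i).
Qed.

(** The sum [S] of the powers of [Gr 1] contains 1 and is stable under [Gr 1], hence is everything;
    since each power sits in its own degree, directness forces equality degree by degree. *)
Lemma graded_expv i : Gr i = (Gr 1%N ^+ i)%VS.
Proof.
have [Di | iD] := ltnP D i.
  apply/eqP; rewrite eqEsubv expv_sub_graded andbT.
  by rewrite (graded_high A_graded Di) sub0v.
pose S := (\sum_(j < D.+1) Gr 1%N ^+ j)%VS.
have Sx : S = fullv.
  apply/eqP; rewrite eqEsubv subvf /= -(graded_gen A_graded).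
  apply: agenv_sub_modl; first by rewrite (sumv_sup ord0) // expv0.
  rewrite big_distrr /=; apply/subv_sumP => j _; rewrite -expvSl.
  (* The one power leaving the range, of exponent [D.+1], lies in [Gr D.+1], which is zero. *)
  have [jD | Dj] := ltnP j.+1 D.+1; first by rewrite (sumv_sup (Ordinal jD)).
  rewrite (subv_trans (expv_sub_graded _)) //.
  by rewrite (graded_high A_graded Dj) sub0v.
apply/eqP; rewrite eq_sym eqEsubv expv_sub_graded; apply/subvP => x xi.
have: x \in S by rewrite Sx memvf.
case/memv_sumP => us usP xE.
(* The decomposition of [x] in [S], minus [x] put in degree [i], sums to zero; its vanishing in
   degree [i] says that [x] is its own component in the [i]-th power. *)
pose vs k :=
  (if insub k is Some j then us j else 0) - (if k == i then x else 0).
have usG (j : 'I_D.+1) : us j \in Gr j.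
  exact: subvP (expv_sub_graded _) _ (usP j isT).
have vsP k : vs k \in Gr k.
  rewrite /vs memvB //; first by case: insubP => [j _ <- | _]; rewrite ?mem0v.
  by case: eqP => [->|_]; rewrite ?mem0v.
have iD1 : (i < D.+1)%N by [].
have vs0 : \sum_(k < D.+1) vs k = 0.
  rewrite sumrB (eq_bigr us) => [|k _]; last by rewrite valK.
  rewrite -xE (bigD1 (Ordinal iD1)) //= eqxx big1 ?addr0 ?subrr // => k.
  by rewrite -val_eqE /= => /negPf->.
have /eqP := graded_unique vsP vs0 i.
rewrite /vs eqxx insubT subr_eq0 => /eqP <-; exact: (usP (Ordinal iD1)).
Qed.

Lemma gradedS i : Gr i.+1 = (Gr 1%N * Gr i)%VS.
Proof. by rewrite !(graded_expv i.+1) (graded_expv i) expvSl. Qed.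

(** Every positive degree is a multiple of [Gr 1], so annihilating [Gr 1] annihilates the irrelevant
    ideal. *)
Lemma mem_socle x :
  (forall b, b \in Gr 1%N -> x * b = 0) -> x \in socle Gr D.
Proof.
move=> x1; suff: (irrelevant Gr D <= lker (amull x))%VS.
  move/subvP => xI; apply/mem_colon0v => b /xI.
  by rewrite memv_ker lfunE => /eqP.
rewrite /irrelevant big_nat; apply/(big_ind (fun U => (U <= _)%VS)).
- exact: sub0v.
- by move=> U V sU sV; rewrite subv_add sU.
case=> // i _; rewrite gradedS; apply/prodvP => u v u1 _.
by rewrite memv_ker lfunE /= mulrA x1 // mul0r.
Qed.

Lemma socle_mul0 x b i : x \in socle Gr D -> b \in Gr i.+1 -> x * b = 0.
Proof.
move=> /mem_colon0v xs bi; have [Di | iD] := ltnP D i.+1.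
  have: b \in 0%VS by rewrite -(graded_high A_graded Di).
  by rewrite memv0 => /eqP->; rewrite mulr0.
apply: xs; apply: subvP bi.
by rewrite /irrelevant (bigD1_seq i.+1) ?iota_uniq ?mem_index_iota //= addvSl.
Qed.

Lemma top_sub_socle : (Gr D <= socle Gr D)%VS.
Proof.
apply/subvP => x xD; apply: mem_socle => b b1; apply/eqP; rewrite -memv0.
by rewrite -(graded_high A_graded (ltnSn D)) -addn1 mul_graded.
Qed.

(** * Multiplication by a linear form *)

Lemma inj_graded {L : A} {i} :
  {in Gr i &, injective ( *%R L)} <->
  (forall a, a \in Gr i -> L * a = 0 -> a = 0).
Proof.
split=> [inj a ai La0 | inj a b ai bi /= /eqP].
  by apply: inj; rewrite ?mem0v ?mulr0.
rewrite -subr_eq0 -mulrBr => /eqP/inj E; apply/eqP.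
by rewrite -subr_eq0 E // memvB.
Qed.

(** Surjectivity climbs one degree at a time: [Gr j.+2] is [Gr 1 * Gr j.+1], and a factor [L] of the
    second term can be pulled out by commutativity. *)
Lemma surj_graded_mono {L : A} {i j} : (i <= j)%N ->
  (forall b, b \in Gr i.+1 -> exists2 a, a \in Gr i & L * a = b) ->
  (forall b, b \in Gr j.+1 -> exists2 a, a \in Gr j & L * a = b).
Proof.
move=> ij si; elim: j ij => [|j IHj]; first by rewrite leqn0 => /eqP <-.
rewrite leq_eqVlt => /predU1P[<- // | /IHj sj] b.
suff /subvP sL : (Gr j.+2 <= amull L @: Gr j.+1)%VS.
  by move/sL/memv_imgP=> [a aj ->]; exists a; rewrite ?lfunE.
rewrite gradedS; apply/prodvP => u v u1 /sj[a aj <-].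
rewrite mulrCA; have := memv_img (amull L) (mul_graded u1 aj).
by rewrite lfunE.
Qed.

Lemma bij_of_max_rank {L : A} {i} : L \in Gr 1%N ->
  \dim (Gr i) = \dim (Gr i.+1) -> max_rank_mul Gr L i ->
  {in Gr i &, injective ( *%R L)} /\
  (forall b, b \in Gr i.+1 -> exists2 a, a \in Gr i & L * a = b).
Proof.
move=> L1 dimE Lmax.
have sLi : (amull L @: Gr i <= Gr i.+1)%VS.
  apply/subvP => _ /memv_imgP[a ai ->]; rewrite lfunE.
  exact: mul_graded L1 ai.
have dimL := limg_ker_dim (amull L) (Gr i).
suff Lim : (amull L @: Gr i)%VS = Gr i.+1.
  split=> [|b]; last first.
    by rewrite -Lim => /memv_imgP[a ai ->]; exists a; rewrite ?lfunE.
  apply/inj_graded => a ai La0; apply/eqP; rewrite -memv0.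
  move/eqP: dimL; rewrite Lim -dimE -[eqbRHS]add0n eqn_add2r dimv_eq0.
  move=> /eqP <-.
  by rewrite memv_cap ai memv_ker lfunE /= La0 eqxx.
apply/eqP; case: Lmax => [/inj_graded inj | surj].
  rewrite eqEdim sLi -dimE limg_dim_eq ?leqnn //.
  apply/eqP; rewrite -subv0; apply/subvP => a /memv_capP[ai].
  by rewrite memv_ker lfunE /= memv0 => /eqP/(inj _ ai)->.
rewrite eqEsubv sLi; apply/subvP => b /surj[a ai <-].
by have := memv_img (amull L) ai; rewrite lfunE.
Qed.

(** * Gorenstein duality and its effect on Lefschetz maps *)

Hypothesis A_gorenstein : gorenstein Gr D.

Lemma socle_top : socle Gr D = Gr D.
Proof.
apply/esym/eqP; rewrite eqEdim top_sub_socle A_gorenstein.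
by rewrite lt0n dimv_eq0 (graded_top A_graded).
Qed.

Lemma mul1_graded_eq0 {i x} : (i < D)%N -> x \in Gr i ->
  (forall b, b \in Gr 1%N -> x * b = 0) -> x = 0.
Proof.
move=> iD xi /mem_socle; rewrite socle_top => xD.
by apply: graded_disjoint xi xD _; rewrite ltn_eqF.
Qed.

(** Induction on [j]: by generation in degree one, each [x * c] with [c] linear pairs to zero with
    [Gr j], so it vanishes; then [x] is a socle element of degree below [D]. *)
Lemma pairing_nondegenerate {i j x} : (i + j = D)%N -> x \in Gr i ->
  (forall b, b \in Gr j -> x * b = 0) -> x = 0.
Proof.
elim: j i x => [|j IHj] i x ijD xi x0.
  by rewrite -[x]mulr1 x0 // (graded_0 A_graded) memv_line.
apply: (mul1_graded_eq0 _ xi) => [|c c1].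
  by rewrite -ijD addnS ltnS leq_addr.
apply: (IHj (i + 1)%N) => [||b bj]; first by rewrite -addnA.
  exact: mul_graded.
by rewrite -mulrA x0 // gradedS memv_mul.
Qed.

(** The pairing into the line [Gr D] embeds [Gr i] in the dual of [Gr j]. Exchanging [i] and [j]
    gives the symmetry of the Hilbert function. *)
Lemma dim_graded_le {i j} : (i + j = D)%N -> (\dim (Gr i) <= \dim (Gr j))%N.
Proof.
move=> ijD; have D1 : \dim (Gr D) = 1%N by rewrite -socle_top.
(* The only coordinate on [Gr D]; it identifies this line with [K]. *)
pose o : 'I_(\dim (Gr D)) := cast_ord (esym D1) ord0.
pose h (x : A) : 'rV[K]_(\dim (Gr j)) :=
  \row_k coord (vbasis (Gr D)) o (x * (vbasis (Gr j))`_k).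
have h_lin : linear h.
  by move=> a x y; apply/rowP => k; rewrite !mxE mulrDl -scalerAl linearP.
pose hL : {linear A -> 'rV_(\dim (Gr j))} :=
  HB.pack h (GRing.isLinear.Build K A 'rV_(\dim (Gr j)) _ h h_lin).
rewrite -(limg_dim_eq (f := linfun hL)).
  by apply: leq_trans (dimvS (subvf _)) _; rewrite dimvf dim_matrix mul1r.
apply/eqP; rewrite -subv0; apply/subvP => x /memv_capP[xi].
rewrite memv_ker lfunE memv0 => /eqP/rowP hx0; apply/eqP.
apply: (pairing_nondegenerate ijD xi) => b bj.
rewrite (coord_vbasis bj) mulr_sumr big1 // => k _.
have xkD : x * (vbasis (Gr j))`_k \in Gr D.
  by rewrite -ijD mul_graded // vbasis_mem // mem_nth // size_tuple.
rewrite -scalerAr (coord_vbasis xkD) big1 ?scaler0 // => l _.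
have -> : l = o by apply: val_inj; case: l => l /=; rewrite D1; case: l.
by have := hx0 k; rewrite !mxE => ->; rewrite scale0r.
Qed.

(** If [L * a = 0], then [L] kills [a * b] for each linear [b]; injectivity one degree higher gives
    [a * b = 0], so [a] is a socle element of degree below [D], hence zero. *)
Lemma inj_graded_mono {L : A} {i j} : (i <= j <= D)%N ->
  {in Gr j &, injective ( *%R L)} -> {in Gr i &, injective ( *%R L)}.
Proof.
(* Writing [i] as [j - (j - i)] turns the descent from [j] into an induction on [j - i]. *)
case/andP=> ij jD /inj_graded; rewrite -(subKn ij).
elim: (j - i)%N (leq_subr i j) => [|k IHk] kj inj.
  by rewrite subn0; apply/inj_graded.
apply/inj_graded => a ai La0.
apply: (mul1_graded_eq0 _ ai) => [|b b1].
  by rewrite (leq_trans _ jD) // ltn_subrL /= (leq_trans _ kj).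
have /inj_graded inj' := IHk (ltnW kj) inj.
apply: inj'; last by rewrite mulrA La0 mul0r.
by have := mul_graded ai b1; rewrite addn1 subnSK.
Qed.

Lemma WLP_middle m L : L \in Gr 1%N -> (m.+1 <= D)%N ->
  \dim (Gr m) = \dim (Gr m.+1) -> max_rank_mul Gr L m ->
  (forall i, (i <= m)%N -> {in Gr i &, injective ( *%R L)}) /\
  (forall i, (m <= i)%N ->
    forall b, b \in Gr i.+1 -> exists2 a, a \in Gr i & L * a = b).
Proof.
move=> L1 mD dimE /(bij_of_max_rank L1 dimE)[inj surj].
split=> i im; last exact: surj_graded_mono im surj.
by apply: inj_graded_mono inj; rewrite im ltnW.
Qed.

End GradedTheory.

(** * The quotient by [(0 : f)] *)

Section Colon0Quotient.
Set Implicit Arguments.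
Unset Strict Implicit.
Variables (K : fieldType) (A : comFalgType K).
Variables (f : A) (f_neq0 : f != 0).
Local Notation I := (colon0_ideal f_neq0).
Local Notation B := (quot_alg I : comFalgType K).
Local Notation proj := (linfun (quot_proj I) : 'Hom(A, B)).

Lemma projE x : proj x = quot_proj I x. Proof. exact: lfunE. Qed.

Lemma proj_eq0 x : (proj x == 0) = (x * f == 0).
Proof. by rewrite projE quot_proj_eq0 mem_colon0. Qed.

Lemma projM x y : proj (x * y) = proj x * proj y.
Proof. by rewrite !projE quot_projM. Qed.

Lemma limg_proj_full : limg proj = fullv.
Proof.
apply/eqP; rewrite eqEsubv subvf; apply/subvP => x _.
by have [a <-] := quot_proj_surj x; rewrite -projE memv_img ?memvf.
Qed.

(** Both maps have kernel [(0 : f)]: the quotient is a copy of the ideal generated by [f]. *)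
Lemma dim_proj (U : {vspace A}) : \dim (proj @: U) = \dim (amulr f @: U).
Proof.
have kerE : lker proj = lker (amulr f).
  by apply/vspaceP => x; rewrite !memv_ker proj_eq0 lfunE.
have := limg_ker_dim proj U; rewrite -(limg_ker_dim (amulr f) U) kerE.
exact: addnI.
Qed.

Variables (Gr : nat -> {vspace A}) (D : nat).
Hypothesis A_graded : standard_graded_artinian Gr D.+1.
Hypothesis f_linear : f \in Gr 1%N.
Hypothesis A_gorenstein : gorenstein Gr D.+1.
Local Notation GrB := (quot_grading I Gr : nat -> {vspace B}).

Lemma mul_linear {i x} : x \in Gr i -> x * f \in Gr i.+1.
Proof. by move=> xi; rewrite -addn1 (mul_graded A_graded). Qed.

Lemma quot_grading_high i : (D < i)%N -> GrB i = 0%VS.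
Proof.
move=> Di; apply/eqP; rewrite -subv0; apply/subvP => _ /memv_imgP[x xi ->].
rewrite memv0 proj_eq0 -memv0 -(graded_high A_graded (i := i.+1)) //.
exact: mul_linear.
Qed.

(** Otherwise [f] would annihilate [Gr D], against the nondegenerate pairing of degrees 1 and [D]
    into [Gr D.+1]. *)
Lemma quot_grading_top : GrB D != 0%VS.
Proof.
apply: contraNneq f_neq0 => B0; apply/eqP.
apply: (pairing_nondegenerate A_graded A_gorenstein (add1n D) f_linear) => b bD.
by apply/eqP; rewrite mulrC -proj_eq0 -memv0 -B0 memv_img.
Qed.

Lemma quot_graded : standard_graded_artinian GrB D.
Proof.
split.
- apply/directv_sum_independent => us usP us0 i _.
  have /fin_all_exists2[vs vsP usE] (j : 'I_D.+1) :
      exists2 x, x \in Gr j & us j = proj x.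
    exact/memv_imgP/usP.
  have vsf0 (j : 'I_D.+1) : vs j * f = 0.
    (* Directness is tested in [A] after multiplying the lifts by [f], which moves degree [j] to
       [j.+1] and leaves degree 0 empty. *)
    pose ws k := if k is k'.+1 then
      (if insub k' is Some j then vs (j : 'I_D.+1) * f else 0) else 0.
    have wsP k : ws k \in Gr k.
      case: k => [|k] /=; first exact: mem0v.
      by case: insubP => [l _ <- | _]; rewrite ?mem0v ?mul_linear.
    have := graded_unique A_graded wsP _ j.+1; rewrite /= valK; apply.
    rewrite big_ord_recl add0r /=; under eq_bigr do rewrite valK.
    apply/eqP; rewrite -mulr_suml -proj_eq0 linear_sum -[X in _ == X]us0.
    by apply/eqP/eq_bigr => k _; rewrite usE.
  by apply/eqP; rewrite usE proj_eq0 vsf0.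
- rewrite -limg_proj_full -(graded_sum A_graded) limg_sum.
  rewrite [in RHS]big_ord_recr /=.
  by rewrite [(proj @: _)%VS](quot_grading_high (ltnSn D)) addv0.
- exact: quot_grading_high.
- exact: quot_grading_top.
- move=> i j; rewrite /quot_grading -(aimgM (linfun_ahom (quot_proj I))).
  exact: limgS (graded_mul A_graded i j).
- rewrite /quot_grading (graded_0 A_graded).
  exact: (aimg1 (linfun_ahom (quot_proj I))).
- rewrite /quot_grading -(aimg_agen (linfun_ahom (quot_proj I))).
  by rewrite (graded_gen A_graded) limg_proj_full.
Qed.

(** The top degree gives dimension at least 1. Conversely, multiplication by [f] carries the
    preimage [S] of the socle into the socle of [A], and its image there has the dimension of the
    quotient's socle. *)
Lemma quot_gorenstein : gorenstein GrB D.
Proof.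
apply/eqP; rewrite eqn_leq andbC lt0n dimv_eq0; apply/andP; split.
  apply: contraNneq quot_grading_top => soc0.
  by rewrite -subv0 -soc0 (top_sub_socle quot_graded).
pose S := (proj @^-1: socle GrB D)%VS.
have <- : (proj @: S)%VS = socle GrB D.
  by rewrite lpreimK ?limg_proj_full ?subvf.
rewrite dim_proj -A_gorenstein; apply/dimvS/subvP => _ /memv_imgP[x xS ->].
rewrite lfunE; apply: (mem_socle A_graded) => b b1 /=.
apply/eqP; rewrite mulrAC -proj_eq0 projM.
by rewrite (socle_mul0 quot_graded (i := 0)) ?memv_img // memv_preim.
Qed.

(** Injectivity is needed in degree [i.+1], not [i], because the class of [a] is seen through
    [a * f]. *)
Lemma quot_max_rank L i :
  {in Gr i.+1 &, injective ( *%R L)} \/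
  (forall b, b \in Gr i.+1 -> exists2 a, a \in Gr i & L * a = b) ->
  max_rank_mul GrB (proj L) i.
Proof.
case=> [/inj_graded inj | surj]; [left | right].
  apply/inj_graded => _ /memv_imgP[a ai ->] /eqP.
  rewrite -projM proj_eq0 -mulrA => /eqP/(inj _ (mul_linear ai)) af0.
  by apply/eqP; rewrite proj_eq0 af0.
move=> _ /memv_imgP[b /surj[a ai <-] ->]; exists (proj a); rewrite ?projM //.
exact: memv_img.
Qed.

Lemma quot_WLP L m : L \in Gr 1%N -> (m <= D)%N ->
  \dim (Gr m) = \dim (Gr m.+1) -> max_rank_mul Gr L m -> WLP GrB D.
Proof.
move=> L1 mD dimE Lm.
have [inj surj] := WLP_middle A_graded A_gorenstein L1 mD dimE Lm.
exists (proj L) => [|i iD]; first exact: memv_img.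
apply: quot_max_rank; have [im | mi] := ltnP i m; first by left; apply: inj.
by right; apply: surj.
Qed.

End Colon0Quotient.

Theorem corollary2p2 (K : fieldType) (charK0 : [pchar K] =i pred0)
    (G : comFalgType K) (Gr : nat -> {vspace G}) (D n : nat)
    (G_graded : standard_graded_artinian Gr D)
    (G_gorenstein : gorenstein Gr D)
    (G_codim : codimension Gr = n) (n_ge1 : (1 <= n)%N)
    (G_WLP : WLP Gr D)
    (f : G) (f_linear : f \in Gr 1%N) (f_neq0 : f != 0)
    (D_cond : let k := D./2 in
       odd D \/ (~~ odd D /\ \dim (Gr k.-1) = \dim (Gr k))) :
  let I := colon0_ideal f_neq0 in
  let A : comFalgType K := quot_alg I in
  let GrA : nat -> {vspace A} := quot_grading I Gr in
  exists DA : nat,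
    [/\ standard_graded_artinian GrA DA,
        gorenstein GrA DA &
        codimension GrA = codimension Gr -> WLP GrA DA].
Proof.
case: D G_graded G_gorenstein G_WLP D_cond => [|D'] gradedG gorG [L L1 Lmax] Dc.
  (* Socle degree 0 would leave no nonzero linear form. *)
  case/eqP: (f_neq0); apply/eqP.
  by rewrite -memv0 -(graded_high gradedG (i := 1)).
have [m mD dimE] : exists2 m, (m <= D')%N & \dim (Gr m) = \dim (Gr m.+1).
  case: Dc => [oddD | [evenD dimE]].
    (* For odd socle degree, [k] and [k.+1] are complementary degrees, so duality equates their
       dimensions. *)
    exists D'.+1./2; first by lia.
    by apply/eqP; rewrite eqn_leq !(dim_graded_le gradedG gorG) //; lia.
  (* A positive even socle degree makes [k] positive, so [k.-1] is a true predecessor. *)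
  exists D'.+1./2.-1; first by lia.
  by rewrite prednK //; lia.
move=> I A GrA; exists D'; split; first exact: quot_graded.
  exact: quot_gorenstein.
by move=> _; apply: quot_WLP (Lmax m _).
Qed.
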